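(* Let $p$ be a prime number and let $G$ be a nontrivial finite $p$-group with an unmixed Beauville structure $\big((x,y,z),(a,b,c)\big)$. Then $G$, together with this Beauville structure, is part of an infinite projective system of finite $p$-groups with compatible unmixed Beauville structures. That is, there exist a projective system $(G_i,\varphi_{ij})$ of finite $p$-groups indexed by a directed set $I$, with all transition maps $\varphi_{ij}\colon G_j\to G_i$ (for $j\ge i$) surjective and with the orders $\#G_i$ unbounded, and for each $i\in I$ an unmixed Beauville structure $\big((x_i,y_i,z_i),(a_i,b_i,c_i)\big)$ on $G_i$, such that $\varphi_{ij}$ maps $(x_j,y_j,z_j)$ to $(x_i,y_i,z_i)$ and $(a_j,b_j,c_j)$ to $(a_i,b_i,c_i)$ entrywise for all $j\ge i$, and such that for some $i_0\in I$ one has $G_{i_0}=G$ with $\big((x_{i_0},y_{i_0},z_{i_0}),(a_{i_0},b_{i_0},c_{i_0})\big)=\big((x,y,z),(a,b,c)\big)$. Moreover, the system can be chosen so that the signature of the first half remains constant throughout the projective system, i.e. the orders $\mathrm{ord}(x_i)$, $\mathrm{ord}(y_i)$, $\mathrm{ord}(z_i)$ do not depend on $i\in I$.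
   Context: An (unmixed) Beauville structure on a finite group $G$ consists of an ordered pair of triples $(x,y,z)$ and $(a,b,c)$ of elements of $G$ such that (1) $xyz=1=abc$; (2) $G$ is generated by $\{x,y,z\}$ and also by $\{a,b,c\}$; (3) no non-trivial power (i.e. power different from $1$) of an element of $\{x,y,z\}$ is conjugate in $G$ to a power of an element of $\{a,b,c\}$. The signature of the Beauville structure is the tuple of orders of $x,y,z,a,b,c$. The individual triples $(x,y,z)$ and $(a,b,c)$ are called the (first and second) halves of the Beauville structure. *)

(* Defs.v *)
From HB Require Import structures.
From mathcomp Require Import all_boot all_order all_fingroup all_solvable.

Set Implicit Arguments.
Unset Strict Implicit.
Unset Printing Implicit Defensive.

Import GroupScope.

(* Unmixed Beauville structures. As the ambient type is finite, natural
   exponents give all the powers of an element. *)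
Definition beauville_structure (gT : finGroupType) (G : {group gT})
    (x y z a b c : gT) : Prop :=
  [/\ x * y * z = 1 /\ a * b * c = 1,
      <<[set x; y; z]>> = G /\ <<[set a; b; c]>> = G
    & forall s t : gT, s \in [set x; y; z] -> t \in [set a; b; c] ->
      forall m n : nat, s ^+ m != 1 -> s ^+ m \notin (t ^+ n) ^: G].

(* A finite group with two triples of elements, bundled so that "the same
   group with the same triples" is an equality in a single type. *)
Record bitripled_group := BitripledGroup {
  ambient : finGroupType;
  carrier : {group ambient};
  fst_x : ambient; fst_y : ambient; fst_z : ambient;
  snd_a : ambient; snd_b : ambient; snd_c : ambient
}.

Definition is_beauville (B : bitripled_group) : Prop :=
  beauville_structure (carrier B) (fst_x B) (fst_y B) (fst_z B)
                      (snd_a B) (snd_b B) (snd_c B).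

Definition directed (d : Order.disp_t) (I : preorderType d) : Prop :=
  inhabited I /\ forall i j : I, exists k : I, (i <= k)%O /\ (j <= k)%O.

(* The comparison is boolean, so phi i j _ does not depend on the proof of
   i <= j. *)
Definition transition_maps (d : Order.disp_t) (I : preorderType d)
    (B : I -> bitripled_group) : Type :=
  forall i j : I, (i <= j)%O -> {morphism carrier (B j) >-> ambient (B i)}.

Definition projective_system (d : Order.disp_t) (I : preorderType d)
    (B : I -> bitripled_group) (phi : transition_maps B) : Prop :=
  [/\ forall (i j : I) (ij : (i <= j)%O),
        phi i j ij @* carrier (B j) \subset carrier (B i),
      forall (i : I) (ii : (i <= i)%O), {in carrier (B i), phi i i ii =1 id}
    & forall (i j k : I) (ij : (i <= j)%O) (jk : (j <= k)%O) (ik : (i <= k)%O),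
        {in carrier (B k), forall g, phi i j ij (phi j k jk g) = phi i k ik g}].

Definition surjective_system (d : Order.disp_t) (I : preorderType d)
    (B : I -> bitripled_group) (phi : transition_maps B) : Prop :=
  forall (i j : I) (ij : (i <= j)%O),
    phi i j ij @* carrier (B j) = carrier (B i).

Definition compatible_triples (d : Order.disp_t) (I : preorderType d)
    (B : I -> bitripled_group) (phi : transition_maps B) : Prop :=
  forall (i j : I) (ij : (i <= j)%O),
    [/\ phi i j ij (fst_x (B j)) = fst_x (B i),
        phi i j ij (fst_y (B j)) = fst_y (B i)
      & phi i j ij (fst_z (B j)) = fst_z (B i)] /\
    [/\ phi i j ij (snd_a (B j)) = snd_a (B i),
        phi i j ij (snd_b (B j)) = snd_b (B i)
      & phi i j ij (snd_c (B j)) = snd_c (B i)].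

Definition constant_first_signature (I : Type) (B : I -> bitripled_group) :
    Prop :=
  forall i j : I,
    [/\ #[fst_x (B i)] = #[fst_x (B j)],
        #[fst_y (B i)] = #[fst_y (B j)]
      & #[fst_z (B i)] = #[fst_z (B j)]].

(* Main.v *)
(** A conjugacy s^m ~ t^n upstairs forces s^m = 1 downstairs, hence upstairs
    when s keeps its order.  So the Beauville condition lifts along any cover
    preserving the orders of x, y, z; and arbitrary lifts of a, b generate any
    2-generated p-group over G, because G is not cyclic (Frattini).  It is
    therefore enough to build one proper p-cover of G = <x, y> in which the
    orders of x, y and x y are unchanged, and to iterate.

    Functions u, v : gT -> F_p are a 1-cochain on the Cayley graph of x, y; they
    lift x and y to the permutations (k, t) |-> (k x, t + u k) and
    (k, t) |-> (k y, t + v k) of gT * F_p.  The orders are preserved when the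
    cochain sums to 0 along every x-, y- and (x y)-cycle, and the cover is
    proper unless the cochain is a coboundary.  Counting dimensions, a suitable
    cochain exists as soon as 1/ord x + 1/ord y + 1/ord z <= 1.  This can only
    fail for p = 2 and G generated by two involutions, and then one of a, b, c
    lies in the rotation subgroup, against the Beauville condition. *)
Require Import Defs.
From HB Require Import structures.
From mathcomp Require Import all_boot all_order all_fingroup all_solvable.
From mathcomp Require boolp.
From mathcomp Require Import ssralg finalg zmodp matrix vector zify.

Set Implicit Arguments.
Unset Strict Implicit.
Unset Printing Implicit Defensive.

Import GroupScope GRing.Theory.

(** * Beauville structures on p-groups *)

Section Triples.
Variable gT : finGroupType.
Implicit Types (G : {group gT}) (x y z a b c s t : gT).

Lemma triple_rot x y z : x * y * z = 1 -> y * z * x = 1.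
Proof.
by move/eqP; rewrite -mulgA -eq_invg_mul => /eqP<-; rewrite mulVg.
Qed.

Lemma set3_rot x y z : [set x; y; z] = [set y; z; x].
Proof. by rewrite -setUA setUC. Qed.

Lemma triple_gen2 x y z : x * y * z = 1 -> <<[set x; y; z]>> = <<[set x; y]>>.
Proof.
move=> xyz; apply/eqP.
rewrite eqEsubset [X in _ && X]genS ?subsetUl // andbT gen_subG subUset.
rewrite subset_gen sub1set -groupV.
move/eqP: xyz; rewrite -eq_invg_mul => /eqP <-.
by rewrite invgK groupM ?mem_gen // !inE eqxx ?orbT.
Qed.

Lemma triple_neq1 G x y z :
  x * y * z = 1 -> <<[set x; y; z]>> = G -> ~~ cyclic G -> x != 1.
Proof.
move=> xyz <-; apply: contraNneq => x1; rewrite triple_gen2 // x1.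
apply/cyclicP; exists y; apply/eqP; rewrite eqEsubset !gen_subG.
by rewrite subUset !sub1set group1 cycle_id mem_gen // !inE eqxx orbT.
Qed.

Lemma triple_neq1_all G x y z s :
    x * y * z = 1 -> <<[set x; y; z]>> = G -> ~~ cyclic G ->
  s \in [set x; y; z] -> s != 1.
Proof.
move=> xyz defG ncG; rewrite !inE => /orP[/orP[]|] /eqP->.
- exact: triple_neq1 defG ncG.
- by rewrite set3_rot in defG; apply: triple_neq1 (triple_rot xyz) defG ncG.
rewrite 2!set3_rot in defG.
exact: triple_neq1 (triple_rot (triple_rot xyz)) defG ncG.
Qed.

Lemma pgroup_order_dvd p G x :
  prime p -> p.-group G -> x \in G -> x != 1 -> (p %| #[x]).
Proof.
move=> p_pr pG Gx; rewrite -order_eq1.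
have /p_natP[[|n] ->] := mem_p_elt pG Gx; first by rewrite expn0 eqxx.
by rewrite expnS dvdn_mulr.
Qed.

Lemma beauville_rot G x y z a b c :
  beauville_structure G x y z a b c -> beauville_structure G y z x a b c.
Proof.
case=> [[xyz abc] gens conj]; rewrite /beauville_structure -(set3_rot x).
by split; first by split=> //; apply: triple_rot.
Qed.

(** A cyclic [p]-group has at most one subgroup of order [p], so nontrivial members of the two
    triples would share a nontrivial power. *)
Lemma beauville_ncyclic p G x y z a b c :
    prime p -> p.-group G -> G :!=: 1 ->
  beauville_structure G x y z a b c -> ~~ cyclic G.
Proof.
move=> p_pr pG ntG [_ [genG1 genG2] conjG]; apply/negP=> cycG.
have nt_gen (A : {set gT}) : <<A>> = G -> exists2 s, s \in A & s != 1.
  move=> defG; apply/exists_inP; apply: contraR ntG => /exists_inPn A1.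
  rewrite -defG -subG1 gen_subG; apply/subsetP=> s /A1.
  by rewrite negbK => /eqP->; rewrite group1.
have [s As nts] := nt_gen _ genG1; have [t At ntt] := nt_gen _ genG2.
have Gs : s \in G by rewrite -genG1 mem_gen.
have Gt : t \in G by rewrite -genG2 mem_gen.
have ord_p r : r \in G -> r != 1 -> #[r ^+ (#[r] %/ p)] = p.
  move=> Gr ntr; have pr := pgroup_order_dvd p_pr pG Gr ntr.
  by rewrite orderXdiv ?dvdn_div // divnA // mulKn.
have := @eq_subG_cyclic _ G <[s ^+ (#[s] %/ p)]> <[t ^+ (#[t] %/ p)]> cycG.
rewrite !cycle_subG !groupX // => /(_ isT isT).
rewrite -![#|<[_]>|]/#[_] !ord_p // eqxx => /eqP eq_st.
have /cycleP[k def_s] : s ^+ (#[s] %/ p) \in <[t ^+ (#[t] %/ p)]>.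
  by rewrite -eq_st cycle_id.
have := conjG s t As At (#[s] %/ p) (#[t] %/ p * k)%N.
rewrite expgM -def_s class_refl -order_eq1 ord_p // => /(_ _)/negP; apply=> //.
by rewrite neq_ltn prime_gt1 ?orbT.
Qed.

(** The rotation subgroup [N] has index at most 2. If [a], [b], [c] all lie in the coset [N s], so
    does their product 1; then [s] is in [N], and [N] is the whole group. *)
Lemma dihedral_triple s t a b c :
    s ^+ 2 = 1 -> t ^+ 2 = 1 -> a * b * c = 1 ->
    [set a; b; c] \subset <<[set s; t]>> ->
  exists2 r, r \in [set a; b; c] & r \in <[s * t]>.
Proof.
move=> s2 t2 abc sABC; pose N := <[s * t]>.
have sV : s^-1 = s by apply/eqP; rewrite eq_invg_mul -expg2 s2.
have tV : t^-1 = t by apply/eqP; rewrite eq_invg_mul -expg2 t2.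
have nNs : s \in 'N(N).
  apply/normP; rewrite /N -cycleJ conjgE !mulgA mulVg mul1g -[in RHS]cycleV.
  by rewrite invMg sV tV.
have mem_N r : r \in [set a; b; c] -> r \in N \/ r * s \in N.
  move/(subsetP sABC) => Gr.
  have : r \in N <*> <[s]>.
    apply: subsetP Gr; rewrite gen_subG subUset !sub1set.
    rewrite (subsetP (joing_subr _ _)) ?cycle_id //=.
    rewrite -(mulKg s t) groupM ?groupV //.
      by rewrite (subsetP (joing_subr _ _)) ?cycle_id.
    by rewrite (subsetP (joing_subl _ _)) ?cycle_id.
  rewrite norm_joinEr ?cycle_subG // => /mulsgP[n _ Nn /cycleP[k ->] ->].
  rewrite -(odd_double_half k) expgD -muln2 mulnC expgM s2 expg1n mulg1.
  case: (odd k); last by left; rewrite mulg1.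
  by right; rewrite expg1 -mulgA -expg2 s2 mulg1.
have [A B C] : [/\ a \in [set a; b; c], b \in [set a; b; c]
    & c \in [set a; b; c]].
  by rewrite !inE !eqxx !orbT.
have [Na|Na] := mem_N a A; first by exists a.
have [Nb|Nb] := mem_N b B; first by exists b.
have [Nc|Nc] := mem_N c C; first by exists c.
exists a => //.
suffices Ns : s \in N by rewrite -(mulgK s a) groupM ?groupV.
(* Conjugating the middle factor by [s] makes the product collapse to [a b c s]. *)
have <- : (a * s) * (b * s) ^ s * (c * s) = s.
  rewrite conjgE sV !mulgA -[a * s * s]mulgA -expg2 s2 mulg1.
  by rewrite -(mulgA (a * b)) -expg2 s2 mulg1 abc mul1g.
by apply: groupM => //; apply: groupM; rewrite // memJ_norm.
Qed.

(** The rotation subgroup [<[x * y]>] equals [<[z]>], so one of [a], [b], [c] would be a nontrivial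
    power of [z]. *)
Lemma beauville_involutions p G x y z a b c :
    prime p -> p.-group G -> G :!=: 1 -> beauville_structure G x y z a b c ->
  ~ (x ^+ 2 = 1 /\ y ^+ 2 = 1).
Proof.
move=> p_pr pG ntG beauG [x2 y2].
have ncG := beauville_ncyclic p_pr pG ntG beauG.
have [[xyz abc] [genG1 genG2] conjG] := beauG.
have [] := dihedral_triple x2 y2 abc.
  by rewrite -(triple_gen2 xyz) genG1 -genG2 subset_gen.
move=> r Ar; have ntr := triple_neq1_all abc genG2 ncG Ar.
have -> : <[x * y]> = <[z]>.
  by move/eqP: xyz; rewrite -eq_invg_mul => /eqP <-; rewrite cycleV.
case/cycleP=> k def_r.
have := conjG z r _ Ar k 1%N; rewrite !inE eqxx !orbT expg1 -def_r class_refl.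
by move=> /(_ isT ntr).
Qed.

(** This is 1/ord x + 1/ord y + 1/ord z <= 1 multiplied by [#|gT|]; indices are taken in all of
    [gT], where the cochains live. For odd [p] the orders are at least 3. For [p = 2] at most one
    order is 2 and the others are at least 4. *)
Lemma beauville_hyperbolic p G x y z a b c :
    prime p -> p.-group G -> G :!=: 1 -> beauville_structure G x y z a b c ->
  #|[set: gT] : <[x]>| + #|[set: gT] : <[y]>| + #|[set: gT] : <[z]>| <= #|gT|.
Proof.
move=> p_pr pG ntG beauG.
have ncG := beauville_ncyclic p_pr pG ntG beauG.
have [[xyz _] [genG1 _] _] := beauG.
have p_dvd s : s \in [set x; y; z] -> p %| #[s].
  move=> As; have nts := triple_neq1_all xyz genG1 ncG As.
  by rewrite (pgroup_order_dvd p_pr pG) // -genG1 mem_gen.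
have inv s : #[s] = 2 -> s ^+ 2 = 1 by move<-; rewrite expg_order.
have noinv u v w : beauville_structure G u v w a b c ->
    #[u] = 2 -> #[v] = 2 -> False.
  by move=> bG /inv ? /inv ?; apply: (beauville_involutions p_pr pG ntG bG).
have bound s k : k <= #[s] -> k * #|[set: gT] : <[s]>| <= #|gT|.
  move=> le_ks; rewrite -cardsT -(Lagrange (subsetT <[s]>)).
  by rewrite leq_mul2r le_ks orbT.
have cases s : s \in [set x; y; z] ->
    3 * #|[set: gT] : <[s]>| <= #|gT| /\
      (p = 2 -> 4 * #|[set: gT] : <[s]>| <= #|gT|)
    \/ #[s] = 2 /\ p = 2.
  move/p_dvd=> /dvdnP[k def_s]; have := prime_gt1 p_pr.
  have := order_gt0 s; rewrite def_s muln_gt0 => /andP[k_gt0 _] p_gt1.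
  have [p2|p_neq2] := eqVneq p 2.
    have [k1|k_neq1] := eqVneq k 1%N; first by right; rewrite k1 p2.
    by left; split=> [|_]; apply: bound; rewrite def_s p2; lia.
  left; split=> [|/eqP]; last by rewrite (negPf p_neq2).
  by apply: bound; rewrite def_s -[3%N]mul1n leq_mul //; lia.
have half s : #[s] = 2 -> 2 * #|[set: gT] : <[s]>| <= #|gT|.
  by move=> o2; apply: bound; rewrite o2.
have [cx cy cz] : [/\ x \in [set x; y; z], y \in [set x; y; z]
    & z \in [set x; y; z]].
  by rewrite !inE !eqxx !orbT.
have [[x3 x4]|[x2 p2]] := cases x cx; have [[y3 y4]|[y2 p2']] := cases y cy;
  have [[z3 z4]|[z2 p2'']] := cases z cz.
- lia.
- by have := half z z2; have := x4 p2''; have := y4 p2''; lia.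
- by have := half y y2; have := x4 p2'; have := z4 p2'; lia.
- by case: (noinv _ _ _ (beauville_rot beauG)).
- by have := half x x2; have := y4 p2; have := z4 p2; lia.
- by case: (noinv _ _ _ (beauville_rot (beauville_rot beauG))).
- by case: (noinv _ _ _ beauG).
by case: (noinv _ _ _ beauG).
Qed.

End Triples.

(** * Cochains on the Cayley graph *)

Lemma leq_dim_capv_ker (F : fieldType) (V W : vectType F)
    (g : {linear V -> W}) (A : {vspace V}) :
  \dim A <= \dim (A :&: lker (linfun g)) + dim W.
Proof.
rewrite -(limg_ker_dim (linfun g) A) leq_add2l -dimvf.
exact: dimvS (subvf _).
Qed.

(** Rank-nullity: [w] pushes the dimension of the image of [f] below [dim U], while the common
    kernel of [g1], [g2], [g3] has dimension at least [dim U]. *)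
Lemma kernels_not_sub_image (F : fieldType) (U V W1 W2 W3 : vectType F)
    (f : {linear U -> V}) (g1 : {linear V -> W1}) (g2 : {linear V -> W2})
    (g3 : {linear V -> W3}) (w : U) :
    w != 0%R -> f w = 0%R -> dim U + (dim W1 + dim W2 + dim W3) <= dim V ->
  exists v, [/\ g1 v = 0%R, g2 v = 0%R, g3 v = 0%R & forall u, v <> f u].
Proof.
move=> w0 fw le_dim.
have dim_im : \dim (limg (linfun f)) < dim U.
  have := limg_ker_dim (linfun f) fullv; rewrite capfv dimvf => <-.
  rewrite -[X in X < _]add0n ltn_add2r lt0n dimv_eq0.
  by apply: contraNneq w0 => ker0; rewrite -memv0 -ker0 memv_ker lfunE fw.
pose K := (lker (linfun g1) :&: lker (linfun g2) :&: lker (linfun g3))%VS.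
have dim_ker : dim U <= \dim K.
  have := leq_dim_capv_ker g1 fullv; rewrite capfv dimvf.
  have := leq_dim_capv_ker g2 (lker (linfun g1)).
  have := leq_dim_capv_ker g3 (lker (linfun g1) :&: lker (linfun g2)).
  by rewrite -/K; lia.
have /subvPn[v] : ~~ (K <= limg (linfun f))%VS.
  by apply: contraL dim_im => /dimvS le; rewrite -leqNgt; apply: leq_trans le.
rewrite !memv_cap !memv_ker !lfunE => /andP[/andP[/eqP g1v /eqP g2v] /eqP g3v].
move=> nfv; exists v; split=> // u def_v.
by case/negP: nfv; rewrite def_v -lfunE memv_img ?memvf.
Qed.

Section Cohomology.
Variables (F : fieldType) (gT : finGroupType).
Local Notation V := {ffun gT -> F^o}.
Implicit Types (x y : gT) (u v e : V).

(** One coordinate per left coset of [<[x]>], that is, per [x]-cycle of the Cayley graph, so the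
    dimension of the target is the index of [<[x]>]. *)
Definition coset_sums x u : 'rV[F]_#|lcosets <[x]> [set: gT]| :=
  (\row_(i < #|lcosets <[x]> [set: gT]|)
     \sum_(k in (enum_val i : {set gT})) u k)%R.

Lemma sum_cycle x k u : 
  (\sum_(h in (k *: <[x]>)%g) u h = \sum_(i < #[x]) u (k * x ^+ i)%g)%R.
Proof.
rewrite -(big_mkord xpredT (fun i => u (k * x ^+ i)%g)).
have -> : (k *: <[x]> = [set k * x ^+ val i | i : 'I_#[x]])%g.
  apply/setP=> h; apply/lcosetP/imsetP => [[_ /cyclePmin[i lt_i ->] ->]|[i _ ->]].
    by exists (Ordinal lt_i).
  by exists (x ^+ i)%g => //; rewrite mem_cycle.
rewrite big_imset ?big_mkord //= => i j _ _ /mulgI/eqP.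
by rewrite eq_expg_mod_order !modn_small // => /eqP/val_inj.
Qed.

Lemma coset_sums0 x u : coset_sums x u = 0%R ->
  forall k, (\sum_(i < #[x]) u (k * x ^+ i)%g = 0)%R.
Proof.
move=> u0 k; rewrite -sum_cycle.
have kx : (k *: <[x]> \in lcosets <[x]> [set: gT])%g.
  by apply/lcosetsP; exists k; rewrite ?inE.
have := congr1 (fun M : 'rV_ _ => M ord0 (enum_rank_in kx (k *: <[x]>)%g)) u0.
by rewrite !mxE enum_rankK_in.
Qed.

Lemma coset_sums_linear x : linear (coset_sums x).
Proof.
move=> a u v; apply/rowP=> i; rewrite !mxE big_distrr -big_split /=.
by apply: eq_bigr => k _; rewrite !ffunE.
Qed.

HB.instance Definition _ x :=
  GRing.isLinear.Build F V _ _ (coset_sums x) (coset_sums_linear x).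

Definition translate x u : V := [ffun k => u (k * x)%g].

Lemma translate_linear x : linear (translate x).
Proof. by move=> a u v; apply/ffunP=> k; rewrite !ffunE. Qed.

HB.instance Definition _ x :=
  GRing.isLinear.Build F V _ _ (translate x) (translate_linear x).

Definition sums1 x (uv : V * V) := coset_sums x uv.1.

Lemma sums1_linear x : linear (sums1 x).
Proof. by move=> a u v; apply: linearP. Qed.

HB.instance Definition _ x :=
  GRing.isLinear.Build F (V * V)%type _ _ (sums1 x) (sums1_linear x).

Definition sums2 x (uv : V * V) := coset_sums x uv.2.

Lemma sums2_linear x : linear (sums2 x).
Proof. by move=> a u v; apply: linearP. Qed.

HB.instance Definition _ x :=
  GRing.isLinear.Build F (V * V)%type _ _ (sums2 x) (sums2_linear x).

(** The cochain along the path [k], [k x], [k x y] is [u k + v (k x)]; it belongs to the product of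
    the lifts of [x] and [y]. *)
Definition sums12 x y (uv : V * V) :=
  coset_sums (x * y) (uv.1 + translate x uv.2)%R.

Lemma sums12_linear x y : linear (sums12 x y).
Proof.
move=> a [u v] [u' v']; rewrite /sums12 /=.
have -> : (a *: u + u' + translate x (a *: v + v') =
    a *: (u + translate x v) + (u' + translate x v'))%R.
  by rewrite linearP scalerDr addrACA.
exact: linearP.
Qed.

HB.instance Definition _ x y :=
  GRing.isLinear.Build F (V * V)%type _ _ (sums12 x y) (sums12_linear x y).

Definition coboundary x y e : V * V := (translate x e - e, translate y e - e)%R.

Lemma coboundary_linear x y : linear (coboundary x y).
Proof.
move=> a u v; rewrite /coboundary.
have D w : (translate w (a *: u + v) - (a *: u + v) =
    a *: (translate w u - u) + (translate w v - v))%R.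
  by rewrite linearP opprD addrACA scalerBr.
by rewrite !D.
Qed.

HB.instance Definition _ x y :=
  GRing.isLinear.Build F V (V * V)%type _ (coboundary x y) (coboundary_linear x y).

(** Cochains form a space of dimension [2 * #|gT|]. At most [#|gT|] linear conditions are imposed,
    and coboundaries have dimension below [#|gT|] because constants have zero coboundary. *)
Lemma exists_noncoboundary x y :
    #|[set: gT] : <[x]>| + #|[set: gT] : <[y]>| + #|[set: gT] : <[x * y]>|
      <= #|gT| ->
  exists u v : {ffun gT -> F},
    [/\ forall k, (\sum_(i < #[x]) u (k * x ^+ i)%g = 0)%R,
        forall k, (\sum_(i < #[y]) v (k * y ^+ i)%g = 0)%R,
        forall k, (\sum_(i < #[(x * y)%g])
          (u (k * (x * y) ^+ i)%g + v (k * (x * y) ^+ i * x)%g) = 0)%R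
      & ~ exists e : gT -> F, forall k,
          u k = (e (k * x)%g - e k)%R /\ v k = (e (k * y)%g - e k)%R].
Proof.
move=> hyp; pose one : V := [ffun => 1%R].
have one_neq0 : one != 0%R.
  by apply/eqP=> /ffunP/(_ 1); rewrite !ffunE; apply/eqP/oner_neq0.
have cob_one : coboundary x y one = 0%R.
  by congr (_, _); apply/ffunP=> k; rewrite !ffunE subrr.
have [|[u v] [Tx Ty Txy] ncob] := @kernels_not_sub_image F _ _ _ _ _
  (coboundary x y) (sums1 x) (sums2 y) (sums12 x y) one one_neq0 cob_one.
  have dV : dim V = #|gT| by exact: muln1.
  have dVV : dim (V * V)%type = (dim V + dim V)%N by [].
  rewrite dVV dV.
  by rewrite !dim_matrix !card_lcosets leq_add2l !mul1r.
exists u, v; split.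
- exact: coset_sums0.
- exact: coset_sums0.
- move=> k; rewrite -[RHS](coset_sums0 Txy k); apply: eq_bigr => i _.
  by rewrite !ffunE.
case=> e ecob; apply: (ncob [ffun k => e k]).
by congr (_, _); apply/ffunP=> k; rewrite !ffunE; case: (ecob k).
Qed.

End Cohomology.

(** * Extensions by permutations of gT * A *)

Section Skew.
Variables (A : finZmodType) (gT : finGroupType).
Implicit Types (g h : gT) (u v : {ffun gT -> A}).

(** An element of the wreath product of [A] by the regular representation of [gT]: [g] moves the
    base and [u] shifts each fibre. As permutations these inherit a group law. *)
Definition skew_fun g u (kt : gT * A) := ((kt.1 * g)%g, (kt.2 + u kt.1)%R).

Lemma skew_fun_inj g u : injective (skew_fun g u).
Proof. by move=> [k t] [k' t'] [/mulIg-> /addIr->]. Qed.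

Definition skew g u : {perm gT * A} := perm (@skew_fun_inj g u).

Lemma skewE g u k t : skew g u (k, t) = (k * g, (t + u k)%R).
Proof. by rewrite permE. Qed.

Lemma skewM g h u v :
  skew g u * skew h v = skew (g * h) [ffun k => u k + v (k * g)%g]%R.
Proof. by apply/permP=> -[k t]; rewrite permM !skewE mulgA ffunE addrA. Qed.

Lemma skewX g u n :
  skew g u ^+ n = skew (g ^+ n) [ffun k => \sum_(i < n) u (k * g ^+ i)%g]%R.
Proof.
elim: n => [|n IHn].
  by apply/permP=> -[k t]; rewrite perm1 skewE ffunE big_ord0 addr0 mulg1.
rewrite expgSr IHn skewM -expgSr; congr skew; apply/ffunP=> k.
by rewrite !ffunE big_ord_recr.
Qed.

Definition skew_base (s : {perm gT * A}) := (s (1, 0%R)).1.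

Lemma skewK g u : skew_base (skew g u) = g.
Proof. by rewrite /skew_base skewE mul1g. Qed.

Definition skews := [set skew g.1 g.2 | g : gT * {ffun gT -> A}].

Lemma skewsP s : reflect (exists g u, s = skew g u) (s \in skews).
Proof.
apply: (iffP imsetP) => [[[g u] _ ->]|[g [u ->]]]; first by exists g, u.
by exists (g, u).
Qed.

Lemma skews_group_set : group_set skews.
Proof.
apply/group_setP; split.
  by apply/skewsP; exists 1, [ffun => 0%R]; apply/permP=> -[k t];
    rewrite perm1 skewE ffunE addr0 mulg1.
move=> _ _ /skewsP[g [u ->]] /skewsP[h [v ->]]; rewrite skewM.
by apply/skewsP; eexists; eexists.
Qed.

Canonical skews_group := Group skews_group_set.

Lemma skew_baseM : {in skews &, {morph skew_base : s t / s * t}}.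
Proof.
by move=> _ _ /skewsP[g [u ->]] /skewsP[h [v ->]]; rewrite skewM !skewK.
Qed.

Canonical skew_base_morphism := Morphism skew_baseM.

End Skew.

(** The [#|G|]-th power of an element above [G] fixes the base and only shifts fibres, so its [p]-th
    power is trivial. Hence the exponent of [H] divides [#|G| * p]. *)
Lemma skews_pgroup (p : nat) (gT : finGroupType) (G : {group gT})
    (H : {group {perm gT * 'F_p}}) :
    prime p -> p.-group G ->
  H \subset skews 'F_p gT -> @skew_base _ _ @* H \subset G -> p.-group H.
Proof.
move=> p_pr pG sHW sHG; rewrite -pnat_exponent.
suffices dvdH : exponent H %| #|G| * p.
  by rewrite (pnat_dvd dvdH) // pnatM [p.-nat _]pG pnat_id.
apply/exponentP=> s Hs; have Ws := subsetP sHW _ Hs.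
have Gs : skew_base s \in G by rewrite (subsetP sHG) ?mem_morphim.
case/skewsP: Ws Gs => g [u ->]; rewrite skewK => Gg.
rewrite expgM skewX expg_cardG // skewX expg1n.
apply/permP=> -[k t]; rewrite skewE perm1 mulg1 ffunE.
under eq_bigr => i _ do rewrite expg1n mulg1.
by rewrite sumr_const card_ord mulrn_pchar ?addr0 ?pchar_Fp.
Qed.

(** The vanishing sums kill the fibre shift of the [#[x]]-th power; projecting to the base gives the
    other divisibility. *)
Lemma skew_order (A : finZmodType) (gT : finGroupType) x (u : {ffun gT -> A}) :
  (forall k, \sum_(i < #[x]) u (k * x ^+ i)%g = 0)%R -> #[skew x u] = #[x].
Proof.
move=> u0; apply/eqP; rewrite eqn_dvd order_dvdn skewX expg_order.
apply/andP; split.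
  by apply/eqP/permP=> -[k t]; rewrite skewE perm1 ffunE u0 addr0 mulg1.
have /(congr1 (@skew_base _ _)) := expg_order (skew x u).
by rewrite skewX skewK order_dvdn /skew_base perm1 => ->.
Qed.

(** [H] is generated by the lifts of [x] and [y] given by a non-coboundary [(u, v)]. An injective
    projection to [G] would integrate [(u, v)] to a function [e]. *)
Lemma proper_cover (p : nat) (gT : finGroupType) (G : {group gT}) x y :
    prime p -> p.-group G ->
    <<[set x; y]>> = G ->
    #|[set: gT] : <[x]>| + #|[set: gT] : <[y]>| + #|[set: gT] : <[x * y]>|
      <= #|gT| ->
  exists (hT : finGroupType) (H : {group hT}) (f : {morphism H >-> gT})
         (X Y : hT),
    [/\ p.-group H, #|G| < #|H|, <<[set X; Y]>> = H, f X = x /\ f Y = y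
      & [/\ #[X] = #[x], #[Y] = #[y] & #[X * Y] = #[x * y]]].
Proof.
move=> p_pr pG genG hyp.
have [u [v [u0 v0 uv0 ncob]]] := exists_noncoboundary 'F_p hyp.
pose X := skew x u; pose Y := skew y v; pose H := <<[set X; Y]>>%G.
have skW g w : skew g w \in skews 'F_p gT by apply/skewsP; exists g, w.
have sHW : H \subset skews 'F_p gT by rewrite gen_subG subUset !sub1set !skW.
pose f := restrm_morphism sHW (skew_base_morphism 'F_p gT).
have HX : X \in H by rewrite mem_gen ?inE ?eqxx.
have HY : Y \in H by rewrite mem_gen ?inE ?eqxx ?orbT.
have fX : f X = x by exact: skewK.
have fY : f Y = y by exact: skewK.
have imf : f @* H = G.
  rewrite morphim_gen; last by rewrite subUset !sub1set HX HY.
  by rewrite morphimU !morphim_set1 // fX fY.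
have imb : @skew_base _ _ @* H = G by rewrite -imf morphim_restrm setIid.
have pH : p.-group H by apply: (skews_pgroup p_pr pG); rewrite ?imb.
exists _, H, f, X, Y; split=> //; last first.
  split; [exact: skew_order | exact: skew_order |].
  rewrite /X /Y skewM skew_order // => k; rewrite -[RHS](uv0 k).
  by apply: eq_bigr => i _; rewrite ffunE.
(* As [f] maps onto [G], equal orders would make it injective. *)
rewrite ltn_neqAle -{2}imf leq_morphim andbT -imf card_im_injm.
apply/negP=> injf; apply: ncob.
(* Every element of H lies above its own element of G, so the H-orbit of a
   point (r, 0) is the graph of a function on r G, with coboundary (u, v). *)
pose r k := repr (k *: G).
have Gr k : (r k)^-1 * k \in f @* H.
  by rewrite imf -mem_lcoset lcoset_sym (mem_repr k) ?lcoset_refl.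
pose e k := (invm injf ((r k)^-1 * k) (r k, 0%R)).2.
(* The points [k] and [k g] share the representative [r k], and the elements of [H] reaching them
   differ by the factor [skew g w], which adds [w k] to the fibre coordinate. *)
have He g w k : g \in G -> skew g w \in H ->
    w k = (e (k * g)%g - e k)%R.
  move=> Gg Hgw; have rg : r (k * g) = r k.
    by rewrite /r lcosetM (lcoset_id Gg).
  rewrite /e rg; case/morphimP: (Gr k) => s Hs _ fs; rewrite fs invmE //.
  have -> : (r k)^-1 * (k * g) = f (s * skew g w).
    by rewrite morphM // -fs -[f (skew g w)]/(skew_base _) skewK mulgA.
  rewrite invmE ?groupM // permM.
  have /skewsP[h [w' def_s]] := subsetP sHW _ Hs.
  have def_k : r k * h = k.
    by rewrite -(skewK h w') -def_s -[skew_base s]/(f s) -fs mulKVg.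
  by rewrite def_s !skewE def_k /= addrC addKr.
have [Gx Gy] : x \in G /\ y \in G by rewrite -genG !mem_gen // !inE eqxx ?orbT.
by exists e => k; split; apply: He.
Qed.


(** * Lifting Beauville structures *)

Lemma index_Phi_gen2 (p : nat) (gT : finGroupType) (G : {group gT}) x y :
  p.-group G -> <<[set x; y]>> = G -> logn p #|G : 'Phi(G)| <= 2.
Proof.
move=> pG genG; have abG := Phi_quotient_abelem pG.
rewrite -card_quotient ?normal_norm ?Phi_normal // -(rank_abelem abG).
rewrite -grank_abelian ?(abelem_abelian abG) //.
apply: leq_trans (quotient_grank (normal_norm (Phi_normal G))) _.
by rewrite -genG (leq_trans (grank_min _)) // cards2; case: eqP.
Qed.

(** Otherwise [A] lies in a maximal subgroup [M], which is generated by ['Phi(H)] and one element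
    [m]. Then [G], the image of [M], is generated by ['Phi(G)] and [f m], hence by [f m] alone, and
    is cyclic. *)
Lemma gen_of_image (p : nat) (hT gT : finGroupType) (H : {group hT})
    (G : {group gT}) (f : {morphism H >-> gT}) X Y (A : {set hT}) :
    prime p -> p.-group H -> <<[set X; Y]>> = H -> f @* H = G -> ~~ cyclic G ->
    A \subset H -> <<f @* A>> = G ->
  <<A>> = H.
Proof.
move=> p_pr pH genH imf ncG sAH genA; apply/eqP.
rewrite eqEsubset gen_subG sAH /=.
have [->//|[M maxM sAM]] := maximal_exists (etrans (gen_subG A H) sAH).
case/negP: ncG; have sPM := Phi_sub_max maxM.
have sMH := proper_sub (maxgroupp maxM).
have nPM : M \subset 'N('Phi(H)) :=
  subset_trans sMH (normal_norm (Phi_normal H)).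
(* M has index p, so M / 'Phi(H) has order at most p. *)
have /cyclicP[mbar defM] : cyclic (M / 'Phi(H)).
  have abM := abelemS (quotientS 'Phi(H) sMH) (Phi_quotient_abelem pH).
  rewrite (abelem_cyclic abM) card_quotient //.
  have := index_Phi_gen2 pH genH.
  rewrite -(Lagrange_index sMH sPM) (p_maximal_index pH maxM).
  by rewrite lognM ?(prime_gt0 p_pr) ?indexg_gt0 // (logn_prime p p_pr) eqxx.
have [m nPm def_m] := cosetP mbar.
have {}defM : 'Phi(H) * <[m]> = M.
  rewrite -(mulSGid sPM) -!quotientK ?cycle_subG //.
  by rewrite quotient_cycle // defM def_m.
have Hm : m \in H.
  by rewrite (subsetP sMH) // -defM (subsetP (mulG_subr _ _)) ?cycle_id.
apply/cyclicP; exists (f m); rewrite -[RHS]genGid.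
apply/esym/(@Phi_nongen _ _ <[f m]>).
have nPfm : <[f m]> \subset 'N('Phi(G)).
  rewrite cycle_subG (subsetP (normal_norm (Phi_normal G))) //.
  by rewrite -imf mem_morphim.
have defPG : f @* 'Phi(H) = 'Phi(G) by rewrite (morphim_Phi _ pH) ?imf.
rewrite norm_joinEr //= -defPG.
have <- : f @* <[m]> = <[f m]> by exact: morphim_cycle.
rewrite -morphimMl ?Phi_sub // defM; apply/eqP; rewrite eqEsubset.
by rewrite -{1}imf morphimS //= -genA -morphim_gen ?morphimS.
Qed.

Lemma beauville_lift (hT gT : finGroupType) (H : {group hT}) (G : {group gT})
    (f : {morphism H >-> gT}) X Y Z A B C :
    X * Y * Z = 1 -> A * B * C = 1 ->
    <<[set X; Y; Z]>> = H -> <<[set A; B; C]>> = H ->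
    f @* H \subset G ->
    {in [set X; Y; Z], forall s, #[s] = #[f s]} ->
    beauville_structure G (f X) (f Y) (f Z) (f A) (f B) (f C) ->
  beauville_structure H X Y Z A B C.
Proof.
move=> XYZ ABC gen1 gen2 sfG eq_ord [_ _ conjG]; split=> // s t Ss At m n.
have Hs : s \in H by rewrite -gen1 mem_gen.
have Ht : t \in H by rewrite -gen2 mem_gen.
apply: contra => /imsetP[h Hh eq_st].
have fS : f s \in [set f X; f Y; f Z].
  by move: Ss; rewrite !inE => /orP[/orP[]|] /eqP->; rewrite eqxx ?orbT.
have fA : f t \in [set f A; f B; f C].
  by move: At; rewrite !inE => /orP[/orP[]|] /eqP->; rewrite eqxx ?orbT.
(* Equality of orders turns [s ^+ m = 1] into [f s ^+ m = 1], which the condition in [G] decides. *)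
rewrite -order_dvdn eq_ord // order_dvdn.
apply/negPn/negP => /(conjG _ _ fS fA m n).
rewrite -!morphX // eq_st morphJ ?groupX //; apply/negP; rewrite negbK.
by apply: imset_f; rewrite (subsetP sfG) ?mem_morphim.
Qed.

(** * The tower *)

(** Surjectivity is not recorded: [covering_image] derives it from the generating triples. *)
Definition covers (B' B : bitripled_group) :=
  exists f : {morphism carrier B' >-> ambient B},
    [/\ f (fst_x B') = fst_x B, f (fst_y B') = fst_y B
      & f (fst_z B') = fst_z B] /\
    [/\ f (snd_a B') = snd_a B, f (snd_b B') = snd_b B
      & f (snd_c B') = snd_c B].

Definition same_first_signature (B B' : bitripled_group) :=
  [/\ #[fst_x B] = #[fst_x B'], #[fst_y B] = #[fst_y B']
    & #[fst_z B] = #[fst_z B']].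

Definition beauville_pgroup (p : nat) (B : bitripled_group) :=
  [/\ is_beauville B, p.-group (carrier B) & carrier B :!=: 1].

(** The first triple lifts through [proper_cover]. For the second, any preimages of [a] and [b]
    serve, completed by the inverse of their product. *)
Lemma beauville_extension p B : prime p -> beauville_pgroup p B ->
  exists B', [/\ beauville_pgroup p B', covers B' B, same_first_signature B' B
    & #|carrier B| < #|carrier B'|].
Proof.
case: B => gT G x y z a b c p_pr [beauG pG ntG]; rewrite /= in pG ntG.
have ncG := beauville_ncyclic p_pr pG ntG beauG.
have hyp := beauville_hyperbolic p_pr pG ntG beauG.
have [/= [xyz abc] [genG1 genG2] conjG] := beauG.
have def_z : (x * y)^-1 = z by apply/eqP; rewrite eq_invg_mul xyz.
have def_c : (a * b)^-1 = c by apply/eqP; rewrite eq_invg_mul abc.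
rewrite -def_z cycleV in hyp; rewrite (triple_gen2 xyz) in genG1.
have [hT [H [f [X [Y]]]]] := proper_cover p_pr pG genG1 hyp.
case=> pH ltGH genH [fX fY] [oX oY oXY].
have [HX HY] : X \in H /\ Y \in H by rewrite -genH !mem_gen // !inE eqxx ?orbT.
have imf : f @* H = G.
  transitivity (f @* <<[set X; Y]>>); first by rewrite genH.
  rewrite morphim_gen; last by rewrite subUset !sub1set HX HY.
  by rewrite morphimU !morphim_set1 // fX fY.
have [Ga Gb] : a \in f @* H /\ b \in f @* H.
  by rewrite imf -genG2 !mem_gen // !inE eqxx ?orbT.
have [[A HA _ fA] [B HB _ fB]] := (morphimP Ga, morphimP Gb).
have fZ : f (X * Y)^-1 = z by rewrite morphV ?groupM // morphM // fX fY.
have fC : f (A * B)^-1 = c by rewrite morphV ?groupM // morphM // -fA -fB.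
have XYZ : X * Y * (X * Y)^-1 = 1 by rewrite mulgV.
have ABC : A * B * (A * B)^-1 = 1 by rewrite mulgV.
have gen1 : <<[set X; Y; (X * Y)^-1]>> = H by rewrite triple_gen2.
have gen2 : <<[set A; B; (A * B)^-1]>> = H.
  have HC : (A * B)^-1 \in H by rewrite groupV groupM.
  apply: gen_of_image p_pr pH genH imf ncG _ _.
    by rewrite !subUset !sub1set HA HB HC.
  by rewrite !morphimU !morphim_set1 // -fA -fB fC.
exists (BitripledGroup H X Y (X * Y)^-1 A B (A * B)^-1); split=> //=.
- split=> //=; last by rewrite -cardG_gt1 (leq_trans _ ltGH) // ltnS cardG_gt0.
  apply: (beauville_lift (G := G) (f := f) XYZ ABC gen1 gen2).
  - by rewrite imf.
  - move=> s; rewrite !inE => /orP[/orP[]|] /eqP->; rewrite ?fX ?fY ?fZ //.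
    by rewrite -def_z !orderV.
  - by rewrite fX fY fZ -fA -fB fC.
- by exists f; rewrite /= fX fY fZ -fA -fB fC.
by split; rewrite //= -def_z !orderV.
Qed.

(** * Composition and uniqueness of covering morphisms *)

Lemma covers_refl B : covers B B.
Proof. by exists (idm_morphism (carrier B)). Qed.

Lemma is_beauville_gen B : is_beauville B ->
  <<[set fst_x B; fst_y B; fst_z B]>> = carrier B.
Proof. by case=> _ []. Qed.

Lemma morphim_triple (aT rT : finGroupType) (H : {group aT})
    (f : {morphism H >-> rT}) x y z :
  <<[set x; y; z]>> = H -> f @* H = <<[set f x; f y; f z]>>.
Proof.
move=> genH; have sH : [set x; y; z] \subset H by rewrite -genH subset_gen.
transitivity (f @* <<[set x; y; z]>>); first by rewrite genH.
move: (sH); rewrite !subUset !sub1set => /andP[/andP[Hx Hy] Hz].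
by rewrite morphim_gen // !morphimU !morphim_set1.
Qed.

(** The equalizer is a subgroup containing the generators. Stating this for plain functions lets it
    apply to the identity and to composites. *)
Lemma eq_morph_beauville (B : bitripled_group) (rT : finGroupType)
    (f g : ambient B -> rT) :
    is_beauville B ->
    {in carrier B &, {morph f : s t / s * t}} ->
    {in carrier B &, {morph g : s t / s * t}} ->
    [/\ f (fst_x B) = g (fst_x B), f (fst_y B) = g (fst_y B)
      & f (fst_z B) = g (fst_z B)] ->
  {in carrier B, f =1 g}.
Proof.
move=> bB fM gM [fgx fgy fgz]; pose f' := Morphism fM; pose g' := Morphism gM.
have eqM : group_set [set s in carrier B | f s == g s].
  apply/group_setP; split=> [|s t].
    by rewrite inE group1 -[f 1]/(f' 1) -[g 1]/(g' 1) !morph1 /=.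
  rewrite !inE => /andP[Bs /eqP fs] /andP[Bt /eqP ft].
  by rewrite groupM //= fM ?gM // fs ft.
have := subset_gen [set fst_x B; fst_y B; fst_z B].
rewrite (is_beauville_gen bB) !subUset !sub1set -andbA => /and3P[Bx By Bz].
have /subsetP sB : <<[set fst_x B; fst_y B; fst_z B]>> \subset Group eqM.
  rewrite gen_subG !subUset !sub1set !inE.
  by rewrite Bx By Bz fgx fgy fgz !eqxx.
move=> s; rewrite -{1}(is_beauville_gen bB) => /sB.
by rewrite inE => /andP[_ /eqP].
Qed.

Lemma covering_image B' B (f : {morphism carrier B' >-> ambient B}) :
    is_beauville B' -> is_beauville B ->
    [/\ f (fst_x B') = fst_x B, f (fst_y B') = fst_y B
      & f (fst_z B') = fst_z B] ->
  f @* carrier B' = carrier B.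
Proof.
move=> b' b [fx fy fz]; rewrite (morphim_triple f (is_beauville_gen b')).
by rewrite fx fy fz is_beauville_gen.
Qed.

Lemma covers_trans B3 B2 B1 :
    is_beauville B3 -> is_beauville B2 ->
  covers B3 B2 -> covers B2 B1 -> covers B3 B1.
Proof.
move=> b3 b2 [f [fxyz fabc]] [g [[gx gy gz] [ga gb gc]]].
have imf := covering_image b3 b2 fxyz.
have sD : carrier B3 \subset f @*^-1 (carrier B2).
  by rewrite -sub_morphim_pre ?imf.
exists (restrm_morphism sD (comp_morphism f g)).
case: fxyz fabc => fx fy fz [fa fb fc].
have hE s : restrm_morphism sD (comp_morphism f g) s = g (f s) by [].
by rewrite !hE fx fy fz fa fb fc.
Qed.

Theorem theorem2 (p : nat) (gT : finGroupType) (G : {group gT})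
    (x y z a b c : gT) (p_pr : prime p) (pG : p.-group G) (ntG : G :!=: 1)
    (beauG : beauville_structure G x y z a b c) :
  exists (d : Order.disp_t) (I : preorderType d) (B : I -> bitripled_group)
         (phi : transition_maps B),
    directed I /\
    projective_system phi /\
    surjective_system phi /\
    (forall i : I, p.-group (carrier (B i))) /\
    (forall n : nat, exists i : I, n < #|carrier (B i)|) /\
    (forall i : I, is_beauville (B i)) /\
    compatible_triples phi /\
    (exists i0 : I, B i0 = BitripledGroup G x y z a b c) /\
    constant_first_signature B.
Proof.
(* Bundling the invariant with the group lets choice produce a successor function that can be
   iterated. *)
pose good := {B | beauville_pgroup p B}.
have /boolp.choice[next nextP] (B : good) : exists B' : good,
    [/\ covers (sval B') (sval B), same_first_signature (sval B') (sval B)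
      & #|carrier (sval B)| < #|carrier (sval B')|].
  case: B => B gB; have [B' [gB' covB sigB ltB]] := beauville_extension p_pr gB.
  by exists (exist _ B' gB').
have gG : beauville_pgroup p (BitripledGroup G x y z a b c) by split.
pose B (i : nat) : bitripled_group := sval (iter i next (exist _ _ gG)).
have gB i : beauville_pgroup p (B i) by exact: (svalP (iter i next _)).
have bB i : is_beauville (B i) by case: (gB i).
have covB (i j : nat) : i <= j -> covers (B j) (B i).
  move/subnK <-; elim: (j - i) => [|n IHn]; first exact: covers_refl.
  apply: covers_trans (bB _) (bB _) _ IHn.
  by case: (nextP (iter (n + i) next (exist _ _ gG))).
have sigB i : same_first_signature (B i) (B 0).
  elim: i => [|i [ox oy oz]]; first by [].
  by case: (nextP (iter i next (exist _ _ gG))) => _ [ox' oy' oz'] _; split;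
    [rewrite -ox -ox' | rewrite -oy -oy' | rewrite -oz -oz'].
(* Orders grow strictly along the tower, which makes them unbounded. *)
have ltB i : i < #|carrier (B i)|.
  elim: i => [|i IHi]; first exact: cardG_gt0.
  by case: (nextP (iter i next (exist _ _ gG))) => _ _; apply: leq_ltn_trans.
(* The maps are chosen separately for each pair [i <= j]. They still compose correctly, since their
   values on the first triple determine them. *)
pose phi : transition_maps (I := nat) B :=
  fun i j ij => sval (boolp.cid (covB i j ij)).
have phiP i j (ij : (i <= j)%O) := svalP (boolp.cid (covB i j ij)).
have im_phi i j (ij : (i <= j)%O) : phi i j ij @* carrier (B j) = carrier (B i).
  by apply: covering_image (bB j) (bB i) _; case: (phiP i j ij).
exists _, nat, B, phi.
split; [|split; [|split; [|split; [|split; [|split; [|split; [|split]]]]]]].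
- split=> [|i j]; first exact: inhabits 0%N.
  by exists (maxn i j); rewrite !leEnat leq_maxl leq_maxr.
- split=> [i j ij|i ii|i j k ij jk ik]; first by rewrite im_phi.
    apply: eq_morph_beauville => //; first exact: morphM.
    by case: (phiP i i ii) => -[-> -> ->].
  have Bphi s : s \in carrier (B k) -> phi j k jk s \in carrier (B j).
    by move=> Bs; rewrite -(im_phi j k jk) mem_morphim.
  apply: eq_morph_beauville => // [s t Bs Bt||]; last 1 first.
  - case: (phiP i k ik) => -[-> -> ->] _; case: (phiP j k jk) => -[-> -> ->] _.
    by case: (phiP i j ij).
  - by rewrite !morphM ?Bphi.
  exact: morphM.
- exact: im_phi.
- by move=> i; case: (gB i).
- by move=> n; exists n.
- exact: bB.
- exact: phiP.
- by exists 0%N.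
by move=> i j; have [-> -> ->] := sigB i; have [-> -> ->] := sigB j.
Qed.
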